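(* Let $Y$ be a real vector space. The class of translative functionals $$\{\varphi_{A,k}: A\subseteq Y,\ k\in Y\setminus\{0\}\}$$ coincides with $$\{\varphi_{A,k}: A\subseteq Y\text{ is }k\text{-directionally closed},\ k\in(-0^+A)\setminus\{0\}\}.$$
   Context: $\mathbb{R}_{+}=\{x\in\mathbb{R}:x\ge 0\}$, $\mathbb{R}_{>}=\{x\in\mathbb{R}:x>0\}$, $\overline{\mathbb{R}}=\mathbb{R}\cup\{-\infty,+\infty\}$, and $\inf\emptyset=+\infty$. The recession cone of $A$ is $0^+A=\{u\in Y: A+\mathbb{R}_{+}u\subseteq A\}$, and $-0^+A=\{-u:u\in 0^+A\}$. For $k\in Y\setminus\{0\}$, the $k$-directional closure $\operatorname{cl}_k(A)$ is the set of all $y\in Y$ such that for each $\lambda\in\mathbb{R}_{>}$ there exists $t\in\mathbb{R}_{+}$ with $t<\lambda$ and $y-tk\in A$; $A$ is $k$-directionally closed if $A=\operatorname{cl}_k(A)$. For $A\subseteq Y$ and $k\in Y\setminus\{0\}$, the Gerstewitz functional $\varphi_{A,k}:Y\to\overline{\mathbb{R}}$ is $\varphi_{A,k}(y)=\inf\{t\in\mathbb{R}: y\in A+tk\}$. A function $\varphi:Y\to\overline{\mathbb{R}}$ is translative if there is some $k\in Y\setminus\{0\}$ with $\varphi(y+tk)=\varphi(y)+t$ for all $y\in Y$, $t\in\mathbb{R}$; the translative functions are exactly the functionals $\varphi_{A,k}$ with $A\subseteq Y$, $k\in Y\setminus\{0\}$. The classes are sets of functions $Y\to\overline{\mathbb{R}}$.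 *)

(* Defs.v *)
From mathcomp Require Import all_boot all_order all_algebra.
From mathcomp Require Import boolp classical_sets reals ereal.

Set Implicit Arguments.
Unset Strict Implicit.
Unset Printing Implicit Defensive.

Import Order.TTheory GRing.Theory Num.Theory.
Local Open Scope classical_set_scope.
Local Open Scope ring_scope.

Section Gerstewitz.
Context {R : realType} {Y : lmodType R}.
Implicit Types (A : set Y) (k : Y).

Definition recession_cone A : set Y :=
  [set u | [set a + t *: u | a in A & t in [set t : R | 0 <= t]] `<=` A].

Definition dir_closure k A : set Y :=
  [set y | forall lambda : R, 0 < lambda ->
     exists t : R, [/\ 0 <= t, t < lambda & A (y - t *: k)]].

Definition dir_closed k A : Prop := A = dir_closure k A.

(* [ereal_inf] of the empty set is +oo. *)
Definition gerstewitz A k : Y -> \bar R :=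
  fun y => ereal_inf [set t%:E | t in [set t : R | [set a + t *: k | a in A] y]].

End Gerstewitz.

(* Main.v *)
Require Import Defs.
From mathcomp Require Import all_boot all_order all_algebra.
From mathcomp Require Import boolp classical_sets reals ereal.

Import Order.TTheory GRing.Theory Num.Theory.
Local Open Scope classical_set_scope.
Local Open Scope ring_scope.

(** Translativity of phi = phi_{A,k} alone recovers phi from its sublevel set
    B = {y | phi y <= 0}: since phi (y - t k) <= 0 iff phi y <= t, one has
    phi_{B,k} = phi.  The same equivalence makes B k-directionally closed and
    stable under translation by - t k for t >= 0. *)

Lemma mem_translate (R : realType) (Y : lmodType R) (A : set Y) (k y : Y)
    (t : R) :
  [set a + t *: k | a in A] y <-> A (y - t *: k).
Proof.
split=> [[a Aa <-]|Ay]; first by rewrite addrK.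
by exists (y - t *: k) => //; rewrite subrK.
Qed.

(** If [r] is admissible for [z + s *: k], then [r - s] is admissible for [z]; this gives [>=] for
    every shift. Shifting back by [- t] from [y + t *: k] gives [<=]. *)
Lemma gerstewitz_translative (R : realType) (Y : lmodType R) (A : set Y)
    (k y : Y) (t : R) :
  gerstewitz A k (y + t *: k) = (gerstewitz A k y + t%:E)%E.
Proof.
have ge z s : (gerstewitz A k z + s%:E <= gerstewitz A k (z + s *: k))%E.
  apply: le_ereal_inf_tmp => _ [r /mem_translate Ar <-].
  rewrite -leeBrDr// -EFinB; apply: ge_ereal_inf.
  exists (r - s)%:E => //; exists (r - s) => //; apply/mem_translate.
  by move: Ar; rewrite scalerBl opprB addrA.
apply/eqP; rewrite eq_le ge andbT.
have := ge (y + t *: k) (- t).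
by rewrite scaleNr addrK EFinN leeBlDr.
Qed.

Definition sublevel0 {R : realType} {Y : lmodType R} (phi : Y -> \bar R) :
  set Y := [set y | (phi y <= 0)%E].

Section Sublevel.
Context {R : realType} {Y : lmodType R}.
Variables (A : set Y) (k : Y).
Let B := sublevel0 (gerstewitz A k).

Lemma sublevel0_gerstewitzB (y : Y) (t : R) :
  B (y - t *: k) <-> (gerstewitz A k y <= t%:E)%E.
Proof.
rewrite /B /sublevel0 /= -scaleNr gerstewitz_translative EFinN.
by rewrite leeBlDr// add0e.
Qed.

Lemma gerstewitz_sublevel0 : gerstewitz B k = gerstewitz A k.
Proof.
apply/funext => y; apply/eqP; rewrite eq_le; apply/andP; split; last first.
  apply: le_ereal_inf_tmp => _ [t /mem_translate Bt <-].
  exact/sublevel0_gerstewitzB.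
(* The infimum runs over real [t] only, so the bound is tested at real [r]: one value suffices when
   [gerstewitz A k y] is finite, while the value [-oo] requires all [r]. *)
have le_fin r : (gerstewitz A k y <= r%:E)%E -> (gerstewitz B k y <= r%:E)%E.
  move=> yr; apply: ge_ereal_inf; exists r%:E => //; exists r => //.
  exact/mem_translate/sublevel0_gerstewitzB.
case E : (gerstewitz A k y) => [r||].
- by apply: le_fin; rewrite E.
- exact: leey.
- rewrite leeNy_eq; apply/eqP/eq_ninfty => r.
  by apply: le_fin; rewrite E leNye.
Qed.

(** A point [y - t *: k] of [B] with [t < e] forces the functional at [y] to be at most [t], hence
    below every [e > 0]. The other inclusion takes [t = 0]. *)
Lemma dir_closed_sublevel0 : dir_closed k B.
Proof.
apply/seteqP; split => [y By lambda lambda0 | y cly].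
  by exists 0; split=> //; rewrite scale0r subr0.
apply/lee_addgt0Pr => e e0; rewrite add0e.
have [t [_ te /sublevel0_gerstewitzB yt]] := cly e e0.
by apply: le_trans yt _; rewrite lee_fin ltW.
Qed.

Lemma recession_cone_sublevel0 : recession_cone B (- k).
Proof.
(* Membership of [a - t *: k] in [B] reduces to a value at most [t] at [a], and that value is at
   most [0]. *)
move=> _ [a Ba [t t0 <-]]; rewrite scalerN; apply/sublevel0_gerstewitzB.
by apply: le_trans Ba _; rewrite lee_fin.
Qed.

End Sublevel.

Theorem corollary3 (R : realType) (Y : lmodType R) :
  [set phi : Y -> \bar R | exists (A : set Y) (k : Y),
     k != 0 /\ phi = gerstewitz A k] =
  [set phi : Y -> \bar R | exists (A : set Y) (k : Y),
     [/\ dir_closed k A,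
         (-%R @` recession_cone A `\` [set 0]) k
       & phi = gerstewitz A k]].
Proof.
(* Only the set changes, from [A] to the sublevel set; the direction [k] is kept. *)
apply/seteqP; split => [_ [A [k [k0 ->]]] | phi [A [k [_ [_ k0] ->]]]].
  exists (sublevel0 (gerstewitz A k)), k; split.
  - exact: dir_closed_sublevel0.
  - split; last by move=> /= k0'; rewrite k0' eqxx in k0.
    by exists (- k); [exact: recession_cone_sublevel0 | rewrite opprK].
  - by rewrite gerstewitz_sublevel0.
by exists A, k; split => //; apply/eqP.
Qed.
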